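(* Let $E$ be a real Hausdorff topological vector space and let $X\subseteq E$ be an infinite-dimensional convex set whose interior in its closed affine hull is non-empty. Let $I\subset\mathbb{R}$ be a compact interval and let $f:X\times I\to\mathbb{R}$ be a function which is lower semicontinuous in $X\times I$ and such that, for each $x\in X$, the function $f(x,\cdot)$ is quasi-convex in $I$. Assume that there is a set $D\subset I$, dense in $I$, such that at least one of the following holds: (i) for each $\lambda\in D$, the function $f(\cdot,\lambda):X\to\mathbb{R}$ is relatively inf-compact in $E$; (ii) for each $\lambda\in D$, the function $f(\cdot,\lambda):X\to\mathbb{R}$ is relatively sequentially inf-compact in $E$. Then $$\sup_{x\in X}\inf_{\lambda\in I}f(x,\lambda)=\inf_{\lambda\in I}\sup_{x\in X}f(x,\lambda)$$ (both sides being understood in the extended real line).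
   Context: Let $E$ be a topological space and $X$ a non-empty subset of $E$. A function $g:X\to\mathbb{R}$ is said to be relatively inf-compact (resp. relatively sequentially inf-compact) in $E$ if, for each $r\in\mathbb{R}$, the sub-level set $g^{-1}(]-\infty,r])=\{x\in X: g(x)\le r\}$ is relatively compact (resp. sequentially relatively compact) in $E$, that is, its closure in $E$ is compact (resp. sequentially compact). A real-valued function $g$ on a convex subset of a vector space is quasi-convex if, for each $r\in\mathbb{R}$, the set $g^{-1}(]-\infty,r])$ is convex. The closed affine hull of $X$ is the closure in $E$ of the affine hull of $X$, and the interior of $X$ in it is taken with respect to the relative topology inherited from $E$. A convex set is infinite-dimensional if its affine hull is infinite-dimensional. $X\times I$ carries the product topology. *)

(* Defs.v *)
From mathcomp Require Export all_boot all_order all_algebra.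
From mathcomp Require Export all_classical all_reals all_analysis.

Set Implicit Arguments.
Unset Strict Implicit.
Unset Printing Implicit Defensive.

Export Order.TTheory GRing.Theory Num.Theory.
Export numFieldNormedType.Exports.

Local Open Scope classical_set_scope.
Local Open Scope ring_scope.

(* A function on a subset A is represented by a total function together with
   A; the notions below depend only on its values on A. *)

Section topology.
Context {T : topologicalType}.
Implicit Types A B : set T.

Definition sequentially_compact A :=
  forall u : nat -> T, (forall n, A (u n)) ->
    exists2 s : nat -> nat, increasing_seq s &
      exists2 x : T, A x & (u \o s) @ \oo --> x.

(* Interior for the relative topology of B. The type [subspace B] keeps the
   points outside B, as isolated points, so this is meant for A `<=` B. *)
Definition interior_in B A : set T := interior (A : set (subspace B)).

Context {R : realType}.

(* Lower semicontinuity for the relative topology of A: the points outside A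
   are isolated in [subspace A] and thus impose no condition. *)
Definition lower_semicontinuous_on A (g : T -> R) :=
  lower_semicontinuous (from_subspace A (EFin \o g)).

Definition sublevel A (g : T -> R) (r : R) : set T :=
  [set x | A x /\ g x <= r].

Definition relatively_inf_compact A (g : T -> R) :=
  forall r, compact (closure (sublevel A g r)).

Definition relatively_sequentially_inf_compact A (g : T -> R) :=
  forall r, sequentially_compact (closure (sublevel A g r)).

End topology.

Section affine.
Context {R : realType} {E : lmodType R}.
Implicit Types A : set E.

Definition quasi_convex A (g : E -> R) :=
  forall r, convex_set [set x : E | A x /\ g x <= r].

Definition linear_span n (v : 'I_n -> E) : set E :=
  [set \sum_(i < n) c i *: v i | c in [set: 'I_n -> R]].

Definition affine_hull A : set E :=
  [set y | exists n (c : 'I_n -> R) (v : 'I_n -> E),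
    [/\ forall i, A (v i), \sum_(i < n) c i = 1 &
        y = \sum_(i < n) c i *: v i]].

Definition direction A : set E := [set x - y | x in A & y in A].

(* The dimension of an affine subspace is that of its direction. *)
Definition infinite_dimensional A :=
  ~ exists n (v : 'I_n -> E),
      (forall i, direction (affine_hull A) (v i)) /\
      direction (affine_hull A) `<=` linear_span v.

End affine.

(* Main.v *)
Require Import Defs.
From mathcomp Require Import ring lra.

(** The inequality sup inf <= inf sup always holds. If it were strict, choose a
    real r strictly between the two sides; it is enough to find one l in [a, b]
    with f x l <= r for every x in X, since then inf sup <= r.

    For x in X let S(x) be the set of those l in [a, b] with f x l <= r. It is a
    non-empty closed interval. If l is in D and the strict superlevel set
    T(l) = {x in X | r < f x l} is connected, then either every x in T(l) has
    S(x) to the left of l, or every x in T(l) has S(x) to the right of l: by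
    the compactness of [a, l] and [l, b] and the lower semicontinuity of f these
    are two disjoint relatively open conditions. So each l in D is such that
    every S(x) meets [a, l], or such that every S(x) meets [l, b]. The supremum
    of the l of the second kind, or a if there are none, then belongs to every
    S(x); this is minimax_alternative, which involves no linear structure on X.

    The linear structure serves to show that T(l) is connected when the
    sublevel set K = X \ T(l) is relatively countably compact, a property which
    follows from both (i) and (ii) (compact_rcc, seq_compact_rcc). Let V be the
    direction of the affine hull of X, and p an interior point of X. Given x and
    y in T(l), a point z = p + v of X is sought such that the segments [x, z]
    and [y, z] avoid K (exists_detour). As x has a neighbourhood which does not
    meet K, the small v for which [x, p + v] meets K form a subset of
    (x - p) + [-M, M] (K - x) for some M (segment_hits_small), and likewise for
    y. If no v were suitable, a neighbourhood of 0 in V would be covered by two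
    such sets. They are bounded, and they are finite-dimensional up to any
    neighbourhood of 0, because K is relatively countably compact. By the
    argument of Riesz (riesz_finite_dim), V would be finite-dimensional. *)

Set Implicit Arguments.
Unset Strict Implicit.
Unset Printing Implicit Defensive.

Local Open Scope classical_set_scope.
Local Open Scope ring_scope.

(** * Neighbourhoods in a topological vector space *)

Section neighbourhoods.
Context {R : realType} {E : topologicalLmodType R}.
Implicit Types (M U V W : set E) (x y v : E) (s : seq E).

Lemma nbhs_affine (x v : E) (t : R) (U : set E) : nbhs (x + t *: v) U ->
  \forall t' \near t & v' \near v, U (x + t' *: v').
Proof.
have cont : continuous (fun z : R^o * E => x + z.1 *: z.2).
  move=> z; apply: (@continuous_comp _ _ _ (fun z : R^o * E => (x, z.1 *: z.2))
    (fun y : E * E => y.1 + y.2)); last exact: add_continuous.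
  apply: cvg_pair; first exact: cvg_cst.
  exact: scale_continuous.
exact: (cont (t, v)).
Qed.

Lemma nbhs_scale (v : E) (t : R) (U : set E) : nbhs (t *: v) U ->
  \forall t' \near t & v' \near v, U (t' *: v').
Proof. exact: (@scale_continuous _ _ (t, v)). Qed.

Lemma nbhs_add x y U : nbhs (x + y) U ->
  \forall x' \near x & y' \near y, U (x' + y').
Proof. exact: (@add_continuous _ (x, y)). Qed.

Lemma nbhs_translate x U : nbhs x U <-> nbhs 0 [set v | U (x + v)].
Proof.
split=> [xU|].
  have : nbhs (x + 0) U by rewrite addr0.
  move=> /nbhs_add [[A B] /= [xA B0]] AB; apply: filterS B0 => v Bv.
  by apply: (AB (x, v)); split => //; exact: nbhs_singleton.
rewrite -[X in nbhs X](addNr x) => /nbhs_add [[A B] /= [xA B0]] AB.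
apply: filterS B0 => v Bv.
have /= := AB (- x, v) (conj (nbhs_singleton xA) Bv).
by rewrite addNKr.
Qed.

Lemma nbhs0_dilate (t : R) U : nbhs 0 U -> nbhs 0 [set v | U (t *: v)].
Proof.
rewrite -[X in nbhs X U](scaler0 _ t) => /nbhs_scale[[A B] /= [tA B0]] AB.
by apply: filterS B0 => v Bv; apply: (AB (t, v)); split => //; exact: nbhs_singleton.
Qed.

Lemma near_scale0 v U : nbhs 0 U ->
  \forall t \near (0 : R) & v' \near v, U (t *: v').
Proof. by move=> U0; apply: nbhs_scale; rewrite scale0r. Qed.

Lemma near0_ball (P : set R) : (\forall t \near 0, P t) ->
  exists2 d, 0 < d & forall t, `|t| < d -> P t.
Proof.
case=> d /= d0 dP; exists d => // t td; apply: dP => /=.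
by rewrite sub0r normrN.
Qed.

Definition balanced U := forall (t : R) v, `|t| <= 1 -> U v -> U (t *: v).

(** The scaling is continuous at (0, 0), so U contains t B for all small t and
    a fixed neighbourhood B of 0; the union of these sets t B is balanced. *)
Lemma balanced_nbhs U : nbhs 0 U ->
  exists W, [/\ nbhs 0 W, balanced W & W `<=` U].
Proof.
move=> /(near_scale0 0)[[A B] /= [/near0_ball[d d0 dA] B0]] AB.
exists [set t *: v | t in [set t | `|t| < d] & v in B]; split.
- have d2 : d / 2 != 0 by rewrite mulf_neq0 ?gt_eqF// invr_eq0.
  apply: filterS (nbhs0_dilate (d / 2)^-1 B0) => v /= Bv.
  exists (d / 2); first by rewrite /= gtr0_norm; lra.
  by exists ((d / 2)^-1 *: v) => //; rewrite scalerA divff// scale1r.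
- move=> t v t1 [t' /= t'd [w Bw <-]]; exists (t * t') => /=.
    by rewrite normrM (le_lt_trans _ t'd)// ler_piMl.
  by exists w => //; rewrite scalerA.
- by move=> _ [t /= td [v Bv <-]]; apply: (AB (t, v)); split => //; exact: dA.
Qed.

End neighbourhoods.

(** * Finite-dimensional subspaces *)

Section span.
Context {R : realType} {E : topologicalLmodType R}.
Implicit Types (M U V W : set E) (x y v : E) (s : seq E).

Definition span_seq s : set E := linear_span (fun i : 'I_(size s) => s`_i).

Lemma span_seq0 : span_seq [::] = [set 0].
Proof.
apply/seteqP; split => [_ [c _ <-]|_ ->] /=; first by rewrite big_ord0.
by exists (fun=> 0) => //; rewrite big_ord0.
Qed.

Lemma span_seq_cons v s :
  span_seq (v :: s) = [set x | exists t : R, span_seq s (x - t *: v)].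
Proof.
apply/seteqP; split => [_ [c _ <-]|x [t [c _ cE]]] /=.
  exists (c ord0); exists (fun i => c (lift ord0 i)) => //.
  by rewrite big_ord_recl/= addrC addKr.
exists (fun i => oapp c t (unlift ord0 i)) => //.
rewrite big_ord_recl/= unlift_none/=.
under eq_bigr do rewrite liftK/=.
by rewrite cE addrC subrK.
Qed.

Definition subvspace V := V 0 /\ forall (t : R) x y, V x -> V y -> V (x + t *: y).

Lemma subvspaceZ V (t : R) x : subvspace V -> V x -> V (t *: x).
Proof. by move=> [V0 VD] Vx; rewrite -[_ *: _]add0r; exact: VD. Qed.

Lemma subvspaceB V x y : subvspace V -> V x -> V y -> V (x - y).
Proof. by move=> [_ VD] Vx Vy; rewrite -scaleN1r; exact: VD. Qed.

Lemma subvspace_span_seq s : subvspace (span_seq s).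
Proof.
split=> [|t _ _ [c _ <-] [d _ <-]].
  by exists (fun=> 0) => //; rewrite big1// => i _; rewrite scale0r.
exists (fun i => c i + t * d i) => //.
rewrite scaler_sumr -big_split/=; apply: eq_bigr => i _.
by rewrite scalerDl scalerA.
Qed.

Lemma span_seq_0 s : span_seq s 0.
Proof. by have [] := subvspace_span_seq s. Qed.

Lemma span_seq_lin s (t : R) x y : span_seq s x -> span_seq s y ->
  span_seq s (x + t *: y).
Proof. by have [_] := subvspace_span_seq s; apply. Qed.

Lemma span_seq_mem s x : x \in s -> span_seq s x.
Proof.
elim: s => // v s ih; rewrite inE span_seq_cons => /predU1P[->|/ih sx] /=.
  by exists 1; rewrite scale1r subrr; exact: span_seq_0.
by exists 0; rewrite scale0r subr0.
Qed.

Lemma span_sub_subvspace V s : subvspace V -> (forall x, x \in s -> V x) ->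
  span_seq s `<=` V.
Proof.
move=> [V0 VD]; elim: s => [|v s ih] sV x; first by rewrite span_seq0 => ->.
rewrite span_seq_cons => -[t st]; rewrite -(subrK (t *: v) x); apply: VD.
  by apply: ih st => y ys; apply: sV; rewrite inE ys orbT.
by apply: sV; exact: mem_head.
Qed.

Lemma span_seq_sub s s' : {subset s <= s'} -> span_seq s `<=` span_seq s'.
Proof.
move=> ss'; apply: span_sub_subvspace; first exact: subvspace_span_seq.
by move=> x /ss'; exact: span_seq_mem.
Qed.

(** If v is not in M, some balanced neighbourhood W of 0 misses v + M, and then
    the elements m + t v of M + R v in W have |t| < 1. So near a given point x
    only the t of some compact interval matter, and for those the conditions
    x - t v outside M are open uniformly in t. *)
Lemma closed_add_line M v : closed M -> subvspace M ->
  closed [set x | exists t : R, M (x - t *: v)].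
Proof.
move=> Mc Ms x clx; apply: contrapT => /= /forallNP xM.
have MZ t y : M y -> M (t *: y) by exact: subvspaceZ.
have [Mv|Mv] := pselect (M v).
  apply: (xM 0); rewrite scale0r subr0; apply: Mc => B /clx[y [/= [t yt] By]].
  by exists y; split => //; rewrite -(subrK (t *: v) y); exact: Ms.2.
have [W [W0 Wb WM]] : exists W, [/\ nbhs 0 W, balanced W &
    W `<=` [set u | ~ M (v + (- 1) *: u)]].
  apply: balanced_nbhs.
  have : nbhs (v + -1 *: 0) (~` M).
    by rewrite scaler0 addr0; apply: open_nbhs_nbhs; split => //; exact: closed_openC.
  move=> /nbhs_affine[[A B] /= [A0 B0]] AB; apply: filterS B0 => u Bu.
  by apply: (AB (-1, u)); split => //; exact: nbhs_singleton.
have Wt m (t : R) : M m -> W (m + t *: v) -> `|t| < 1.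
  move=> Mm Wmt; rewrite ltNge; apply/negP => t1.
  have t0 : t != 0 by rewrite -normr_gt0 (lt_le_trans _ t1).
  have tm1 : `|t^-1| <= 1 by rewrite normfV invf_le1 // normr_gt0.
  apply: (WM _ (Wb _ _ tm1 Wmt)).
  rewrite scalerDr [_ *: (t *: v)]scalerA mulVf// scale1r scalerDr [-1 *: v]scaleN1r.
  by rewrite addrCA subrr addr0; exact/MZ/MZ.
have [[A O] /= [/near0_ball[d d0 dA] Ox] AO] := near_scale0 x W0.
set t0 := d / 2; have t00 : 0 < t0 by rewrite divr_gt0.
have Wt0 y : O y -> W (t0 *: y).
  move=> Oy; apply: (AO (t0, y)); split => //; apply: dA.
  by rewrite gtr0_norm// ltr_pdivrMr// ltr_pMr// ltr1n.
have nx : \forall y \near x, `[- t0^-1, t0^-1] `<=` [set t | ~ M (y - t *: v)].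
  apply: ((compact_near_coveringP _).1 (@segment_compact R _ _)) => t _.
  have : nbhs (x + (-1) *: (t *: v)) (~` M).
    apply: open_nbhs_nbhs; split; first exact: closed_openC.
    by rewrite scaleN1r; exact: xM.
  rewrite scaleN1r => /nbhs_add[[B1 B2] /= [xB1 tB2]] B12.
  move: tB2; rewrite -scaleNr => /nbhs_scale[[C1 C2] /= [tC1 vC2]] C12.
  exists (-%R @^-1` C1, B1); first split => //=.
    exact: (@opp_continuous R^o t).
  move=> [t' y] /= [Ct' By]; rewrite -scaleNr; apply: (B12 (y, _)); split => //=.
  by apply: (C12 (- t', v)); split => //=; exact: nbhs_singleton.
have [y [/= [t yt] [nyt Oy]]] := clx _ (filterI nx Ox).
move: (yt); apply: nyt => /=; rewrite in_itv/= -ler_norml.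
have : W (t0 *: (y - t *: v) + (t0 * t) *: v).
  by rewrite -scalerA -scalerDr subrK; exact: Wt0.
move=> /(Wt _ _ (MZ _ _ yt)); rewrite normrM gtr0_norm// -ltr_pdivlMl// mulr1.
exact: ltW.
Qed.

Lemma closed_span_seq s : hausdorff_space E -> closed (span_seq s).
Proof.
move=> hE; elim: s => [|v s ih].
  by rewrite span_seq0; apply: accessible_closed_set1; exact: hausdorff_accessible.
rewrite span_seq_cons; apply: closed_add_line => //.
exact: subvspace_span_seq.
Qed.

End span.

(** * Relatively countably compact sets *)

Section rcc.
Context {T : topologicalType}.
Implicit Types S : set T.

(** The cluster points may lie outside S. This is the common consequence of the
    two kinds of compactness of the closure of S. *)
Definition relatively_countably_compact S :=
  forall u : nat -> T, (forall n, S (u n)) -> cluster (u @ \oo) !=set0.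

Lemma cluster_infinitely_often (u : nat -> T) (p : T) (O : set T) (m : nat) :
  cluster (u @ \oo) p -> nbhs p O -> exists2 n, (m <= n)%N & O (u n).
Proof.
move=> up pO; have : (u @ \oo) [set u n | n in [set n | (m <= n)%N]].
  by exists m => // n /= mn; exists n.
by move=> /up/(_ pO)[_ [[n /= mn <-] On]]; exists n.
Qed.

Lemma compact_rcc S : compact (closure S) -> relatively_countably_compact S.
Proof.
move=> cS u uS; have [|p [_ pu]] := cS (u @ \oo) _; last by exists p.
by exists 0 => // n _; exact: subset_closure.
Qed.

Lemma seq_compact_rcc S :
  sequentially_compact (closure S) -> relatively_countably_compact S.
Proof.
move=> cS u uS.
have [s si [p _ sp]] := cS u (fun n => subset_closure (uS n)).
exists p => A B [N _ NA] /sp[M _ MB].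
have sid n : (n <= s n)%N.
  elim: n => // n ih; apply: leq_ltn_trans ih _.
  by rewrite ltnNge; have := si n.+1 n; rewrite !leEnat ltnn => ->.
exists (u (s (maxn N M))); split.
  by apply: NA => /=; rewrite (leq_trans _ (sid _))// leq_maxl.
by apply: MB => /=; exact: leq_maxr.
Qed.

End rcc.

(** * Bounded and almost finite-dimensional sets *)

Section bounded.
Context {R : realType} {E : topologicalLmodType R}.
Implicit Types (S K M U V W : set E) (x y v : E) (s : seq E).

Lemma rcc_translate K x : relatively_countably_compact K ->
  relatively_countably_compact [set k - x | k in K].
Proof.
move=> Kc u uK; have [|p up] := Kc (fun n => u n + x).
  by move=> n; have [k Kk <-] := uK n; rewrite subrK.
exists (p - x) => A B [N _ NA] /nbhs_add[[A' B'] /= [pA' xB']] AB'.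
have [n Nn On] := cluster_infinitely_often N up pA'.
exists (u n); split; first exact: NA.
by have := AB' (u n + x, - x) (conj On (nbhs_singleton xB')); rewrite /= addrK.
Qed.

Definition tvs_bounded S :=
  forall U, nbhs 0 U -> \forall t \near (0 : R), forall x, S x -> U (t *: x).

(** A weakening of total boundedness, in which spans of finite sets replace
    finite sets. It suffices for the argument of Riesz, and it passes from S to
    the set of all t c, with c in S and t in a bounded interval, by scaling
    alone, with no partition of that interval. *)
Definition near_finite_dim V S := forall U, nbhs 0 U ->
  exists2 s, (forall x, x \in s -> V x) &
    forall x, S x -> exists2 y, span_seq s y & U (x - y).

(** Otherwise t_n x_n lies outside U for some x_n in K and some t_n tending to 0.
    Continuity of the scaling at (0, p) contradicts this at a cluster point p of
    the sequence x. *)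
Lemma rcc_bounded K : relatively_countably_compact K -> tvs_bounded K.
Proof.
move=> Kc U U0; apply: contrapT => nb.
have ex n : exists tx : R * E, [/\ `|tx.1| < n.+1%:R^-1, K tx.2 & ~ U (tx.1 *: tx.2)].
  apply: contrapT => /forallNP nex; apply: nb.
  exists n.+1%:R^-1; first by rewrite /= invr_gt0.
  move=> t /=; rewrite sub0r normrN => tn x Kx.
  by apply: contrapT => nU; apply: (nex (t, x)).
have [u uP] := choice ex.
have [|p up] := Kc (fun n => (u n).2) _; first by move=> n; case: (uP n).
have [[A O] /= [/near0_ball[d d0 dA] pO] AO] := near_scale0 p U0.
have [N _ Nd] := near_infty_natSinv_lt (PosNum d0).
have [n Nn On] := cluster_infinitely_often N up pO.
have [und _] := uP n; apply; apply: (AO (u n)); split => //=.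
by apply: dA; apply: lt_trans und _; exact: Nd.
Qed.

(** Otherwise a sequence in K can be chosen greedily, each term being outside
    the span of the previous ones plus U; the differences of its terms are then
    outside U, so that it has no cluster point. *)
Lemma rcc_near_finite_dim K : relatively_countably_compact K ->
  near_finite_dim K K.
Proof.
move=> Kc U U0; apply: contrapT => nex.
have ex s : exists x, (forall y, y \in s -> K y) ->
    K x /\ forall y, span_seq s y -> ~ U (x - y).
  have [sK|?] := pselect (forall y, y \in s -> K y); last by exists 0.
  apply: contrapT => /forallNP nx; apply: nex; exists s => // x Kx.
  apply: contrapT => nU; apply: (nx x) => _; split => // y sy Uxy.
  by apply: nU; exists y.
have [pick pickP] := choice ex.
(* s n lists the first n terms, the latest one in front *)
pose s := fix s n := if n is n'.+1 then pick (s n') :: s n' else [::].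
have sK n y : y \in s n -> K y.
  elim: n y => //= n ih y; rewrite inE => /predU1P[->|/ih//].
  by have [] := pickP _ ih.
have sS m n : (m <= n)%N -> {subset s m <= s n}.
  move=> /subnK <-; elim: (n - m)%N => // k ih y /ih.
  by rewrite /= inE orbC => ->.
have [|p up] := Kc (fun n => pick (s n)) _.
  by move=> n; have [] := pickP _ (@sK n).
have : nbhs (p + -1 *: p) U by rewrite scaleN1r subrr.
move=> /nbhs_add[[A B] /= [pA]].
move=> /nbhs_scale[[C D] /= [C1 pD]] CDB AB.
have [m _ Dm] := cluster_infinitely_often 0 up pD.
have [n mn An] := cluster_infinitely_often m.+1 up pA.
have [_ /(_ (pick (s m)))] := pickP _ (@sK n); apply.
  by apply: span_seq_mem; apply: (sS m.+1 n mn); rewrite /= mem_head.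
have := AB (_, _) (conj An (CDB (_, _) (conj (nbhs_singleton C1) Dm))).
by rewrite /= scaleN1r.
Qed.

Lemma tvs_boundedS S S' : S `<=` S' -> tvs_bounded S' -> tvs_bounded S.
Proof. by move=> SS b U /b; apply: filterS => t h x /SS; exact: h. Qed.

Lemma tvs_boundedU S S' : tvs_bounded S -> tvs_bounded S' -> tvs_bounded (S `|` S').
Proof.
move=> b b' U U0; apply: filterS2 (b _ U0) (b' _ U0) => t h h' x.
by case=> [/h|/h'].
Qed.

Lemma near_finite_dimS V S S' :
  S `<=` S' -> near_finite_dim V S' -> near_finite_dim V S.
Proof. by move=> SS f U /f[s sV h]; exists s => // x /SS; exact: h. Qed.

Lemma near_finite_dimU V S S' : near_finite_dim V S -> near_finite_dim V S' ->
  near_finite_dim V (S `|` S').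
Proof.
move=> f f' U U0; have [s sV h] := f _ U0; have [s' sV' h'] := f' _ U0.
exists (s ++ s') => [x|x [/h|/h'] [y sy Uxy]].
- by rewrite mem_cat => /orP[/sV|/sV'].
- by exists y => //; apply: span_seq_sub sy => z; rewrite mem_cat => ->.
- by exists y => //; apply: span_seq_sub sy => z; rewrite mem_cat orbC => ->.
Qed.

(** These are the sets w + [-M, M] S. *)
Definition dilations (w : E) (M : R) S : set E :=
  [set w + tc.1 *: tc.2 | tc in [set tc : R * E | `|tc.1| <= M /\ S tc.2]].

Lemma tvs_bounded_dilations w (M : R) S : 0 < M -> tvs_bounded S ->
  tvs_bounded (dilations w M S).
Proof.
move=> M0 Sb U; rewrite -[X in nbhs X](addr0 0) => /nbhs_add[[A B] /= [A0 B0]] AB.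
have [[C D] /= [C0 wD] CD] := near_scale0 w A0.
have /near0_ball[d d0 dB] := Sb _ B0.
have MM : (\forall t \near (0 : R), `|t * M| < d).
  exists (d / M); first by rewrite /= divr_gt0.
  by move=> t /=; rewrite sub0r normrN normrM (gtr0_norm M0) ltr_pdivlMr.
apply: filterS (filterI C0 MM) => t [Ct tM] _ [[t' c] /= [t'M Sc] <-].
rewrite scalerDr scalerA; apply: (AB (_, _)); split => /=.
  by apply: (CD (t, w)); split => //; exact: nbhs_singleton.
apply: dB => //; apply: le_lt_trans tM.
by rewrite !normrM ler_wpM2l// (le_trans t'M)// ler_norm.
Qed.

Lemma near_finite_dim_dilations V w (M : R) S : 0 < M -> V w ->
  near_finite_dim V S -> near_finite_dim V (dilations w M S).
Proof.
move=> M0 Vw fS U /balanced_nbhs[W [W0 Wb WU]].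
have [s sV h] := fS _ (nbhs0_dilate M W0).
exists (w :: s) => [x|_ [[t c] /= [tM /h[y sy Wy]] <-]].
  by rewrite inE => /predU1P[->//|/sV].
exists (w + t *: y).
  rewrite span_seq_cons; exists 1; rewrite scale1r addrC addKr.
  exact: subvspaceZ (subvspace_span_seq s) sy.
rewrite opprD addrACA subrr add0r -scalerBr; apply: WU.
rewrite -[t](@divfK _ M) ?gt_eqF// -scalerA; apply: Wb => //.
by rewrite normrM normfV (gtr0_norm M0) ler_pdivrMr// mul1r.
Qed.

End bounded.

(** * Avoiding a relatively countably compact set *)

Section detour.
Context {R : realType} {E : topologicalLmodType R}.
Implicit Types (S K U V : set E) (x y v : E) (s : seq E).

(** Riesz: a bounded neighbourhood N of 0 in V contained in L + N / 2, with L a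
    finite-dimensional subspace of V, is contained in L + N / 2 ^ k for all k,
    hence in the closure of L. The latter is L itself, and N spans V. *)
Lemma riesz_finite_dim V U : hausdorff_space E -> subvspace V -> nbhs 0 U ->
  tvs_bounded (V `&` U) -> near_finite_dim V (V `&` U) ->
  exists2 s, (forall x, x \in s -> V x) & V `<=` span_seq s.
Proof.
move=> hE Vs U0 bVU fVU.
have [s sV sU] := fVU _ (nbhs0_dilate 2 U0).
exists s => //; have sV' : span_seq s `<=` V by exact: span_sub_subvspace.
have approx x k : V x -> U x ->
    exists2 y, span_seq s y & (V `&` U) (2 ^+ k *: (x - y)).
  move=> Vx Ux; elim: k => [|k [y sy VUy]].
    by exists 0; [exact: span_seq_0|rewrite subr0 scale1r].
  have [y' sy' Uy'] := sU _ VUy; exists (y + 2 ^- k *: y'); first exact: span_seq_lin.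
  have e : 2 ^+ k.+1 *: (x - (y + 2 ^- k *: y')) = 2 *: (2 ^+ k *: (x - y) - y').
    by rewrite exprS -scalerA opprD addrA scalerBr scalerA divff ?scale1r// expf_neq0.
  rewrite e; split => //; apply: subvspaceZ => //.
  by apply: subvspaceB => //; [exact: VUy.1|exact: sV'].
have VUs x : V x -> U x -> span_seq s x.
  move=> Vx Ux; apply: (closed_span_seq hE) => B /nbhs_translate/bVU/near0_ball[d d0 dB].
  have [N _ /(_ N (leqnn _)) Nd] := near_infty_natSinv_expn_lt (PosNum d0).
  have [y sy VUy] := approx x N Vx Ux; exists y; split => //.
  have := dB (- 2 ^- N) _ _ VUy; rewrite /= scalerA mulNr mulVf ?expf_neq0//.
  rewrite scaleN1r opprB addrC subrK; apply.
  by rewrite normrN ger0_norm ?invr_ge0 ?exprn_ge0// -div1r.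
move=> x Vx; have [[A O] /= [/near0_ball[d d0 dA] xO] AO] := near_scale0 x U0.
have d2 : d / 2 != 0 by rewrite mulf_neq0 ?gt_eqF// invr_eq0.
rewrite -[x](@scalerK _ _ (d / 2))//; apply: (subvspaceZ _ (subvspace_span_seq s)).
apply: VUs; first exact: subvspaceZ.
apply: (AO (d / 2, x)); split; last exact: nbhs_singleton.
by apply: dA; rewrite gtr0_norm ?divr_gt0// ltr_pdivrMr// ltr_pMr// ltr1n.
Qed.

(** The segment goes from x to p + v. The parameter is v rather than p + v, so
    that this set can be compared with the neighbourhoods of 0. *)
Definition segment_hits K p x : set E :=
  [set v | exists2 s : R, 0 <= s <= 1 & K (x + s *: (p + v - x))].

(** If x + s (p + v - x) is in K, then s cannot be too small, uniformly in small
    v, since x has a neighbourhood which does not meet K. So v is x - p plus a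
    bounded multiple 1 / s of an element of K - x. *)
Lemma segment_hits_small V K p x : relatively_countably_compact K ->
  (forall k, K k -> V (k - x)) -> V (x - p) ->
  (\forall k \near x, ~ K k) ->
  exists2 N, nbhs 0 N & tvs_bounded (N `&` segment_hits K p x) /\
    near_finite_dim V (N `&` segment_hits K p x).
Proof.
move=> Kc KV Vxp xK.
have : \forall t \near (0 : R) & v \near (0 : E), ~ K (x + t *: (p - x + v)).
  have : nbhs (x + 0 *: (p - x + 0)) (~` K) by rewrite scale0r addr0.
  move=> /nbhs_affine[[A B] /= [A0 /nbhs_add[[C D] /= [C0 D0] CD]] AB].
  exists (A, D) => //= -[t v] /= [At Dv]; apply: (AB (t, _)); split => //=.
  by apply: (CD (_, _)); split => //; exact: nbhs_singleton.
move=> [[A N] /= [/near0_ball[d d0 dA] N0]] AN.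
have sub : N `&` segment_hits K p x `<=` dilations (x - p) d^-1 [set k - x | k in K].
  move=> v [Nv [s /andP[s0 s1] Ks]].
  have ds : d <= s.
    rewrite leNgt; apply/negP => sd.
    have := AN (s, v) (conj (dA _ _) Nv); rewrite ger0_norm// => /(_ sd).
    by rewrite /= addrAC.
  have sp : 0 < s by exact: lt_le_trans ds.
  exists (s^-1, s *: (p + v - x)) => /=; first split.
    by rewrite ger0_norm ?invr_ge0// lef_pV2.
    by eexists; [exact: Ks|rewrite addrC addKr].
  rewrite scalerA mulVf ?gt_eqF// scale1r.
  by rewrite [p + v - x]addrAC -(opprB p x) addKr.
have d'0 : 0 < d^-1 by rewrite invr_gt0.
have Cc := rcc_translate (x := x) Kc.
exists N => //; split.
  by apply: tvs_boundedS sub _; apply: tvs_bounded_dilations => //; exact: rcc_bounded.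
apply: near_finite_dimS sub _; apply: near_finite_dim_dilations => //.
move=> U U0; have [s sK h] := rcc_near_finite_dim Cc U0; exists s => // _ /sK[k Kk <-].
exact: KV.
Qed.

(** A common end point p + v, with v small, of two segments avoiding K: otherwise
    a neighbourhood of 0 in V is covered by two bounded and almost
    finite-dimensional sets, and V is finite-dimensional. *)
Lemma exists_detour V K U p x y : hausdorff_space E -> subvspace V ->
  ~ (exists2 s, (forall v, v \in s -> V v) & V `<=` span_seq s) ->
  relatively_countably_compact K ->
  (forall k, K k -> V (k - x)) -> (forall k, K k -> V (k - y)) ->
  V (x - p) -> V (y - p) ->
  (\forall k \near x, ~ K k) -> (\forall k \near y, ~ K k) ->
  nbhs 0 U ->
  exists v, [/\ V v, U v, ~ segment_hits K p x v & ~ segment_hits K p y v].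
Proof.
move=> hE Vs Vinf Kc KVx KVy Vx Vy xK yK U0.
have [N N0 [Nb Nf]] := segment_hits_small Kc KVx Vx xK.
have [N' N'0 [N'b N'f]] := segment_hits_small Kc KVy Vy yK.
apply: contrapT => /forallNP nex; apply: Vinf.
set W := U `&` (N `&` N'); have W0 : nbhs 0 W by exact: filterI U0 (filterI N0 N'0).
have sub : V `&` W `<=` (N `&` segment_hits K p x) `|` (N' `&` segment_hits K p y).
  move=> v [Vv [Uv [Nv N'v]]].
  have [?|nx] := pselect (segment_hits K p x v); first by left.
  have [?|ny] := pselect (segment_hits K p y v); first by right.
  by exfalso; apply: (nex v).
apply: (riesz_finite_dim hE Vs W0).
  by apply: tvs_boundedS sub _; exact: tvs_boundedU.
by apply: near_finite_dimS sub _; exact: near_finite_dimU.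
Qed.

End detour.

(** * Connectedness of the complement in X *)

Lemma connected_pairs {T : topologicalType} (A : set T) :
  (forall x y, A x -> A y -> exists C, [/\ connected C, C `<=` A, C x & C y]) ->
  connected A.
Proof.
move=> AC; have [[x Ax]|] := pselect (A !=set0); last first.
  by move=> /set0P/negP/negbNE/eqP ->; exact: connected0.
rewrite (_ : A = connected_component A x); first exact: component_connected.
apply/seteqP; split; last exact: connected_component_sub.
by move=> y Ay; have [C [Cc CA Cx Cy]] := AC _ _ Ax Ay; exists C.
Qed.

Section affine.
Context {R : realType} {E : lmodType R}.
Implicit Types (X : set E).

Lemma affine_hull_line X (t : R) x y : affine_hull X x -> affine_hull X y ->
  affine_hull X ((1 - t) *: x + t *: y).
Proof.
move=> [n [c [v [vX c1 ->]]]] [m [d [w [wX d1 ->]]]].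
exists (n + m)%N.
exists (fun i => match fintype.split i with inl j => (1 - t) * c j | inr j => t * d j end).
exists (fun i => match fintype.split i with inl j => v j | inr j => w j end).
have sl (i : 'I_n) : fintype.split (lshift m i) = inl i.
  by exact: (unsplitK (inl i : 'I_n + 'I_m)).
have sr (i : 'I_m) : fintype.split (rshift n i) = inr i.
  by exact: (unsplitK (inr i : 'I_n + 'I_m)).
split; first by move=> i; case: (fintype.split i).
- rewrite big_split_ord/=; under eq_bigr do rewrite sl.
  under [X in _ + X]eq_bigr do rewrite sr.
  by rewrite -!mulr_sumr c1 d1 !mulr1 subrK.
- rewrite big_split_ord/= !scaler_sumr; congr (_ + _).
    by apply: eq_bigr => i _; rewrite sl scalerA.
  by apply: eq_bigr => i _; rewrite sr scalerA.
Qed.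

Lemma affine_hullD X (t : R) x y z : affine_hull X x -> affine_hull X y ->
  affine_hull X z -> affine_hull X (x + t *: (y - z)).
Proof.
move=> Xx Xy Xz.
(* the point is the midpoint of x + 2 t (y - x) and x - 2 t (z - x) *)
have := affine_hull_line 2^-1 (affine_hull_line (2 * t) Xx Xy)
  (affine_hull_line (- 2 * t) Xx Xz).
set w := (w in affine_hull X w -> _); suff -> : w = x + t *: (y - z) by [].
rewrite /w !scalerDr !scalerA addrACA -scalerDl scalerN -scaleNr.
rewrite -[x in RHS]scale1r.
by congr (_ *: _ + (_ *: _ + _ *: _)); field.
Qed.

Lemma affine_hull_sub X : X `<=` affine_hull X.
Proof.
move=> x Xx; exists 1%N, (fun=> 1), (fun=> x).
by rewrite !big_ord1 scale1r.
Qed.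

Lemma direction_affine_hull X x y :
  X x -> X y -> direction (affine_hull X) (x - y).
Proof.
move=> Xx Xy; exists x; first exact: affine_hull_sub.
by exists y => //; exact: affine_hull_sub.
Qed.

Lemma convex_segment X (s : R) x y : convex_set X -> X x -> X y ->
  0 <= s <= 1 -> X (x + s *: (y - x)).
Proof.
move=> cX Xx Xy /andP[s0 s1].
have := cX y x (Itv01 s0 s1) (mem_set Xy) (mem_set Xx).
rewrite inE; suff -> : x + s *: (y - x) = s *: y + (1 - s) *: x by [].
by rewrite scalerBr scalerBl scale1r addrCA.
Qed.

End affine.

Section tvs.
Context {R : realType} {E : topologicalLmodType R}.
Implicit Types X K : set E.

Lemma subvspace_direction X : X !=set0 -> subvspace (direction (affine_hull X)).
Proof.
move=> [p /affine_hull_sub Xp]; split.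
  by exists p => //; exists p => //; rewrite subrr.
move=> t _ _ [x Xx [x' Xx' <-]] [y Xy [y' Xy' <-]].
exists (x + t *: (y - y')); first exact: affine_hullD.
by exists x' => //; rewrite addrAC.
Qed.

Lemma segment_connected_tvs (x z : E) :
  connected [set x + s *: (z - x) | s in `[0, 1]%classic : set R].
Proof.
apply: (connected_continuous_connected (@segment_connected _ _ _)).
apply: continuous_subspaceT => s U /nbhs_affine[[A B] /= [As Bz]] AB.
apply: filterS As => t At; apply: (AB (t, z - x)); split => //.
exact: nbhs_singleton.
Qed.

(** Any two points of X outside K are joined by two segments with a common end
    point near p; the latter is in X as p is an interior point of X. *)
Lemma connected_setD_rcc X K : hausdorff_space E -> convex_set X ->
  infinite_dimensional X -> interior_in (closure (affine_hull X)) X !=set0 ->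
  K `<=` X -> relatively_countably_compact K ->
  (forall x, X x -> ~ K x -> \forall k \near x, ~ K k) ->
  connected (X `\` K).
Proof.
move=> hE cX infX [p intp] KX Kc Ko.
have Xp : X p := nbhs_singleton intp.
have clp : closure (affine_hull X) p by apply/subset_closure/affine_hull_sub.
have pX : \forall v \near (0 : E), direction (affine_hull X) v -> X (p + v).
  move: intp; rewrite /interior_in /interior/= /nbhs/= -nbhs_subspace_in//.
  move=> /nbhs_translate; apply: filterS => v /= pv [x Xx [y Xy xyv]].
  apply: pv; apply: subset_closure; rewrite -xyv -[x - y]scale1r.
  by apply: affine_hullD => //; exact: affine_hull_sub.
have Vs : subvspace (direction (affine_hull X)) by apply: subvspace_direction; exists p.
have Vinf : ~ (exists2 s, (forall v, v \in s -> direction (affine_hull X) v) &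
    direction (affine_hull X) `<=` span_seq s).
  move=> [s sV Vs']; apply: infX; exists (size s), (fun i => s`_i); split => // i.
  by apply: sV; exact: mem_nth.
apply: connected_pairs => x y [Xx nKx] [Xy nKy].
have [v [Vv /(_ Vv) Xv nx ny]] := exists_detour hE Vs Vinf Kc
  (fun k Kk => direction_affine_hull (KX _ Kk) Xx)
  (fun k Kk => direction_affine_hull (KX _ Kk) Xy)
  (direction_affine_hull Xx Xp) (direction_affine_hull Xy Xp)
  (Ko _ Xx nKx) (Ko _ Xy nKy) pX.
have seg w : X w -> ~ segment_hits K p w v ->
    [/\ connected [set w + s *: (p + v - w) | s in `[0, 1]%classic : set R],
      [set w + s *: (p + v - w) | s in `[0, 1]%classic : set R] `<=` X `\` K,
      [set w + s *: (p + v - w) | s in `[0, 1]%classic : set R] w &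
      [set w + s *: (p + v - w) | s in `[0, 1]%classic : set R] (p + v)].
  move=> Xw nw; split.
  - exact: segment_connected_tvs.
  - move=> _ [s /= s01 <-]; split; first exact: convex_segment.
    by move=> Ks; apply: nw; exists s => //; rewrite in_itv in s01.
  - by exists 0; rewrite /= ?in_itv/= ?lexx ?ler01// scale0r addr0.
  - by exists 1; rewrite /= ?in_itv/= ?lexx ?ler01// scale1r addrC subrK.
have [cx sx xx vx] := seg _ Xx nx; have [cy sy yy vy] := seg _ Xy ny.
eexists; split; first by apply: connectedU cx cy; exists (p + v).
- by rewrite subUset.
- by left.
- by right.
Qed.

End tvs.

(** * The minimax alternative *)

Section interval.
Context {R : realType} {T : topologicalType}.

(** A parameter l of D is on the left of or on the right of all the intervals
    S(x) = {m in [a, b] | f x m <= r} not containing l, by connectedness; the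
    supremum of a and of the l on the left is common to all the S(x). *)
Lemma minimax_alternative (X : set T) (a b r : R) (f : T -> R -> R) (D : set R) :
  a <= b -> D `<=` `[a, b] -> `[a, b] `<=` closure D ->
  (forall x l, X x -> l \in `[a, b] -> r < f x l ->
    \forall y \near x & m \near l, X y -> m \in `[a, b] -> r < f y m) ->
  (forall x l m n, X x -> l \in `[a, b] -> n \in `[a, b] -> l <= m <= n ->
    f x l <= r -> f x n <= r -> f x m <= r) ->
  (forall l, D l -> connected [set x | X x /\ r < f x l]) ->
  (forall x, X x -> exists2 l, l \in `[a, b] & f x l <= r) ->
  exists2 l, l \in `[a, b] & forall x, X x -> f x l <= r.
Proof.
move=> ab DI Dd fl fq Dc fr.
pose G c d := [set y : T | X y -> forall m, m \in `[c, d] -> r < f y m].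
(* lower semicontinuity, made uniform over [c, d] by compactness *)
have Go x c d : X x -> a <= c -> d <= b -> (forall m, m \in `[c, d] -> r < f x m) ->
    nbhs x (G c d).
  move=> Xx ac db fx.
  have : \forall y \near x, `[c, d] `<=`
      [set m | X y -> m \in `[a, b] -> r < f y m].
    apply: ((compact_near_coveringP _).1 (@segment_compact R _ _)) => m /= cdm.
    have abm : m \in `[a, b].
      by move: cdm; rewrite !in_itv/= => /andP[cm md]; rewrite (le_trans ac)//= (le_trans md).
    case: (fl _ _ Xx abm (fx _ cdm)) => -[A B] /= [xA mB] AB.
    by exists (B, A) => // -[m' y] /= [Bm' Ay]; exact: (AB (y, m')).
  apply: filterS => y yP Xy m cdm; apply: yP => //.
  by move: cdm; rewrite !in_itv/= => /andP[cm md]; rewrite (le_trans ac)//= (le_trans md).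
pose lft l := forall x, X x -> exists2 m, m \in `[a, l] & f x m <= r.
pose rgt l := forall x, X x -> exists2 m, m \in `[l, b] & f x m <= r.
have notP c d x : X x -> ~ (forall m, m \in `[c, d] -> r < f x m) ->
    exists2 m, m \in `[c, d] & f x m <= r.
  move=> Xx /existsNP[m /not_implyP[mI /negP]]; rewrite -leNgt => ?; by exists m.
have alt l : D l -> lft l \/ rgt l.
  move=> Dl; have := DI _ Dl; rewrite /= in_itv/= => /andP[al lb].
  set Tl := [set x | X x /\ r < f x l].
  pose B := [set x | Tl x /\ forall m, m \in `[a, l] -> r < f x m].
  have [[x0 Bx0]|B0] := pselect (B !=set0); last first.
    left => x Xx; have [fxl|rf] := leP (f x l) r; first by exists l => //; rewrite in_itv/= al lexx.
    by apply: notP => // h; apply: B0; exists x.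
  have BT : B = Tl.
    apply: (Dc _ Dl); first by exists x0.
    - exists (interior (G a l)); first exact: open_interior.
      apply/seteqP; split => x /=.
        by move=> [[Xx rx] fx]; split=> //; apply: Go.
      move=> [[Xx rx] /nbhs_singleton Gx]; split => //; exact: Gx.
    (* an interval S(x) not containing l meets exactly one of [a, l], [l, b] *)
    - exists (~` interior (G l b)); first exact/open_closedC/open_interior.
      apply/seteqP; split => x /=.
        move=> [[Xx rx] fx]; split=> // /nbhs_singleton /(_ Xx) Gx.
        have [m mI fm] := fr _ Xx; move: mI; rewrite in_itv/= => /andP[am mb].
        have [ml|lm] := leP m l.
          by have := fx m; rewrite in_itv/= am ml ltNge fm => /(_ isT).
        by have := Gx m; rewrite in_itv/= (ltW lm) mb ltNge fm => /(_ isT).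
      move=> [[Xx rx] nG]; split=> // m; rewrite in_itv/= => /andP[am ml].
      rewrite ltNge; apply/negP => fm.
      have [|n] := notP l b x Xx; first by move=> h; apply: nG; exact: Go.
      rewrite in_itv/= => /andP[ln nb] fn.
      have := fq x m l n Xx _ _ _ fm fn; rewrite !in_itv/= am ln nb ml.
      by rewrite (le_trans ml lb) (le_trans al ln) leNgt rx => /(_ isT isT isT).
  right => x Xx; have [fxl|rf] := leP (f x l) r; first by exists l => //; rewrite in_itv/= lexx.
  have [_ Bx] : B x by rewrite BT.
  have [m + fm] := fr _ Xx; rewrite in_itv/= => /andP[am mb].
  exists m => //; rewrite in_itv/= mb andbT leNgt; apply/negP => ml.
  by have := Bx m; rewrite in_itv/= am (ltW ml) ltNge fm => /(_ isT).
(* a is added to make the set non-empty *)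
pose A := [set l | l = a \/ D l /\ rgt l].
have AI l : A l -> a <= l <= b.
  by move=> [->|[/DI + _]]; rewrite ?lexx//= in_itv.
have supA : has_sup A.
  by split; [exists a; left|exists b => l /AI/andP[]].
have aA : a <= sup A by apply: ub_le_sup; [exact: supA.2|left].
have Ab : sup A <= b by apply: ge_sup => [|l /AI/andP[]//]; exact: supA.1.
have mI : sup A \in `[a, b] by rewrite in_itv/= aA.
exists (sup A) => // x Xx; rewrite leNgt; apply/negP => rx.
case: (fl _ _ Xx mI rx) => -[P Q] /= [Px Qm] PQ.
have [d /= d0 dQ] := Qm.
have fd m : a <= m <= b -> `|sup A - m| < d -> r < f x m.
  by move=> mab /dQ Qm'; apply: (PQ (x, m)) => //; split => //; exact: nbhs_singleton.
have [m] := fr _ Xx; rewrite in_itv/= => /andP[am mb] fm.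
have [mA|Am|mE] := ltgtP m (sup A); last by move: rx; rewrite -mE ltNge fm.
(* S(x) is on the left of sup A at a distance at least d, whereas it meets
   [l, b] for some l of A at a distance less than d from sup A *)
- have [l Al dl] := sup_adherent d0 supA.
  have la : sup A - d < l by [].
  have lA : l <= sup A by apply: ub_le_sup => //; exact: supA.2.
  have /andP[al lb] := AI _ Al.
  have [n + fn] : exists2 n, n \in `[l, b] & f x n <= r.
    case: Al => [->|[_ Rl]]; last exact: Rl.
    by exists m => //; rewrite in_itv/= am.
  rewrite in_itv/= => /andP[ln nb].
  have [nA|An] := leP n (sup A).
    suff : r < f x n by rewrite ltNge fn.
    apply: fd; first by rewrite (le_trans al ln).
    by rewrite ger0_norm ?subr_ge0//; lra.
  have := fq x m (sup A) n Xx _ _ _ fm fn; rewrite !in_itv/= am mb nb (ltW mA) (ltW An).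
  by rewrite (le_trans al ln) leNgt rx => /(_ isT isT isT).
(* S(x) is on the right of sup A at a distance at least d, whereas it meets
   [a, l] for any l of D on the right of sup A, and such l exist arbitrarily
   close to sup A *)
- pose e := Num.min (sup A + d) m.
  have Ae : sup A < e by rewrite lt_min Am andbT ltrDl.
  have := Dd ((sup A + e) / 2) _ (`]sup A, e[%classic).
  case=> [| |l [Dl]].
  + rewrite /= in_itv/=.
    have : e <= m by rewrite ge_min lexx orbT.
    by move=> em; apply/andP; split; lra.
  + apply: open_nbhs_nbhs; split; first exact: interval_open.
    by rewrite /= in_itv/=; apply/andP; split; lra.
  rewrite /= in_itv/= lt_min => /andP[Al /andP[lAd lm]].
  case: (alt _ Dl) => [Ll|Rl]; last first.
    by have := ub_le_sup supA.2 (or_intror (conj Dl Rl)); rewrite leNgt Al.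
  have [n + fn] := Ll _ Xx; rewrite in_itv/= => /andP[an nl].
  have nb : n <= b by rewrite (le_trans nl)// (le_trans (ltW lm)).
  have [nA|An] := leP n (sup A).
    have := fq x n (sup A) m Xx _ _ _ fn fm; rewrite !in_itv/= am mb nb nA (ltW Am) an.
    by rewrite leNgt rx => /(_ isT isT isT).
  suff : r < f x n by rewrite ltNge fn.
  apply: fd; first by rewrite an.
  by rewrite ltr0_norm ?subr_lt0//; lra.
Qed.

End interval.

(** * The minimax equality *)

Section ereal.
Local Open Scope ereal_scope.

Lemma lt_ereal_real {R : realFieldType} (x y : \bar R) : x < y ->
  exists2 r : R, x < r%:E & r%:E < y.
Proof.
case: x y => [x| |] [y| |]//=.
- rewrite lte_fin => xy; exists ((x + y) / 2)%R; rewrite lte_fin; lra.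
- by move=> _; exists (x + 1)%R; rewrite ?ltry// lte_fin; lra.
- by move=> _; exists (y - 1)%R; rewrite ?ltNyr// lte_fin; lra.
- by move=> _; exists 0%R; rewrite ?ltNyr ?ltry.
Qed.

End ereal.

Lemma quasi_convex_between {R : realType} (I : set R) (g : R -> R) (r l m n : R) :
  quasi_convex (E := R^o) I g -> I l -> I n -> l <= m <= n ->
  g l <= r -> g n <= r -> g m <= r.
Proof.
move=> qg Il In /andP[lm mn] gl gn.
have [ln|ln] := eqVneq l n; first by have -> : m = l by lra.
have ln0 : 0 < n - l by rewrite subr_gt0 lt_neqAle ln (le_trans lm).
have s01 : 0 <= (m - l) / (n - l) <= 1.
  by rewrite divr_ge0 ?ler_pdivrMr//; lra.
have [_] := convex_segment (E := R^o) (qg r) (conj Il gl) (conj In gn) s01.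
suff -> : l + ((m - l) / (n - l) : R) *: (n - l : R^o) = m by [].
by rewrite -[_ *: _]/(_ * _) divfK ?gt_eqF// addrC subrK.
Qed.

Lemma lower_semicontinuous_on_near {R : realType} {E : topologicalType}
    (X : set E) (I : set R) (f : E -> R -> R) (r : R) x l :
  lower_semicontinuous_on (X `*` I) (fun z : E * R => f z.1 z.2) ->
  X x -> I l -> r < f x l ->
  \forall y \near x & m \near l, X y -> I m -> r < f y m.
Proof.
move=> lf Xx Il rf.
have [V] := lf (x, l) r rf.
have XIxl : (X `*` I) (x, l) by [].
rewrite /nbhs/= -nbhs_subspace_in// => -[[A B] /= ABxl ABV] Vr.
exists (A, B) => // -[y m] /ABV /= Vym Xy Im.
by have := Vr (y, m) (Vym (conj Xy Im)); rewrite lte_fin.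
Qed.

Theorem theorem1 (R : realType) (E : topologicalLmodType R)
    (X : set E) (a b : R) (f : E -> R -> R) (D : set R) :
  hausdorff_space E ->
  convex_set X ->
  infinite_dimensional X ->
  interior_in (closure (affine_hull X)) X !=set0 ->
  a <= b ->
  lower_semicontinuous_on (X `*` `[a, b]) (fun z : E * R => f z.1 z.2) ->
  (forall x, X x -> quasi_convex (E := R^o) `[a, b] (f x)) ->
  D `<=` `[a, b] ->
  `[a, b] `<=` closure D ->
  (forall l, D l -> relatively_inf_compact X (f ^~ l)) \/
  (forall l, D l -> relatively_sequentially_inf_compact X (f ^~ l)) ->
  ereal_sup [set ereal_inf [set (f x l)%:E | l in `[a, b]] | x in X] =
  ereal_inf [set ereal_sup [set (f x l)%:E | x in X] | l in `[a, b]].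
Proof.
move=> hE cX infX intX ab lf qf DI Dd Kcpt.
apply/eqP; rewrite eq_le; apply/andP; split.
  apply: ge_ereal_sup => _ [x Xx <-]; apply: le_ereal_inf_tmp => _ [l lI <-].
  apply: (@le_trans _ _ (f x l)%:E); first by apply: ereal_inf_lbound; exists l.
  by apply: ereal_sup_ubound; exists x.
rewrite leNgt; apply/negP => /lt_ereal_real[r supr rinf].
have Kc l : D l -> relatively_countably_compact (sublevel X (f ^~ l) r).
  by case: Kcpt => h Dl; [apply: compact_rcc|apply: seq_compact_rcc]; exact: h.
have [||||l lI fl] := minimax_alternative (r := r) (f := f) (X := X) ab DI Dd.
- by move=> x l Xx lI; exact: lower_semicontinuous_on_near lf Xx lI.
- by move=> x l m n Xx lI nI; exact: quasi_convex_between (qf _ Xx) lI nI.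
- move=> l Dl; rewrite (_ : [set x | _] = X `\` sublevel X (f ^~ l) r); last first.
    apply/seteqP; split => x /= [Xx].
      by rewrite ltNge => /negP rf; split=> // -[].
    by move=> nf; split=> //; rewrite ltNge; apply/negP => fr; apply: nf.
  apply: connected_setD_rcc => //; [by move=> x []|exact: Kc|].
  move=> x Xx nf; have rf : r < f x l.
    by rewrite ltNge; apply/negP => fr; apply: nf.
  have := lower_semicontinuous_on_near lf Xx (DI _ Dl) rf.
  case=> -[P Q] /= [Px Ql] PQ; apply: filterS Px => y Py [Xy].
  have := PQ (y, l) (conj Py (nbhs_singleton Ql)) Xy (DI _ Dl).
  by rewrite /= ltNge => /negP.
- move=> x Xx.
  have /ereal_inf_lt[_ [l lI <-]] : (ereal_inf [set (f x l)%:E | l in `[a, b]] < r%:E)%E.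
    by apply: le_lt_trans supr; apply: ereal_sup_ubound; exists x.
  by rewrite lte_fin => /ltW fr; exists l.
move: rinf; rewrite ltNge => /negP; apply.
apply: (@le_trans _ _ (ereal_sup [set (f x l)%:E | x in X])).
  by apply: ereal_inf_lbound; exists l.
by apply: ge_ereal_sup => _ [x Xx <-]; rewrite lee_fin; exact: fl.
Qed.
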